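(* Let $p_t(x\mid x_0)=\mathcal{N}(x;\alpha_tx_0,\sigma_t^2I)$ be the continuized DDPM forward path. Then it is generated by the variance-preserving SDE $$\mathrm{d}X_t=-\tfrac12\beta(t)X_t\,\mathrm{d}t+\sqrt{\beta(t)}\,\mathrm{d}W_t,\qquad \beta(t):=-2\frac{\dot\alpha_t}{\alpha_t}=g_t^2\ge0,$$ where the identity $-2\dot\alpha_t/\alpha_t=g_t^2$ is part of the assertion. That is, for every $x_0\in\mathbb{R}^d$, $t\in(0,1)$ and $x\in\mathbb{R}^d$, $$\partial_tp_t(x\mid x_0)=-\nabla\cdot\Bigl(-\tfrac12\beta(t)\,x\,p_t(x\mid x_0)\Bigr)+\tfrac12\beta(t)\,\Delta p_t(x\mid x_0).$$
   Context: Discrete schedule: $0=t_0<t_1<\cdots<t_N=1$ is a time grid, $b_k\in(0,1)$, $a_k:=1-b_k$, $\bar a_k:=\prod_{i=1}^ka_i$, $\bar a_0:=1$. Continuized DDPM forward path: differentiable functions $\alpha_t,\sigma_t\ge0$ on $[0,1]$ are chosen with $\alpha_{t_k}=\sqrt{\bar a_k}$, $\sigma_{t_k}=\sqrt{1-\bar a_k}$ for all $k$, and $\alpha_t^2+\sigma_t^2=1$ for all $t\in[0,1]$; it is assumed that $\alpha_t>0$ and $\sigma_t>0$ for $t\in(0,1)$. The path is $p_t(x\mid x_0):=\mathcal{N}(x;\alpha_tx_0,\sigma_t^2I)$ on $\mathbb{R}^d$. Set $g_t^2:=\frac{\mathrm{d}}{\mathrm{d}t}\sigma_t^2-2\frac{\dot\alpha_t}{\alpha_t}\sigma_t^2$,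 which is assumed nonnegative (standing assumption). A dot denotes $\mathrm{d}/\mathrm{d}t$; $W_t$ is a standard $d$-dimensional Brownian motion; differential operators act on $x$. Convention: an SDE $\mathrm{d}X_t=b_t(X_t)\mathrm{d}t+c_t\mathrm{d}W_t$ generates a density path when the path satisfies $\partial_tp_t=-\nabla\cdot(b_tp_t)+\frac12c_t^2\Delta p_t$. *)

(* Defs.v *)
From mathcomp Require Import all_boot all_order all_algebra.
From mathcomp Require Import all_classical all_reals all_analysis.

Set Implicit Arguments.
Unset Strict Implicit.
Unset Printing Implicit Defensive.

Import Order.TTheory GRing.Theory Num.Theory.
Import numFieldNormedType.Exports.

Local Open Scope classical_set_scope.
Local Open Scope ring_scope.

(* Derivative of a function of time given on [0, 1]: the limit of the
   difference quotient is taken along times of [0, 1] only, so it is one-sided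
   at 0 and at 1 and agrees with derive1 f on ]0, 1[. *)
Definition quot01 (R : realType) (f : R -> R) (t : R) (s : R) : R :=
  (s - t)^-1 * (f s - f t).

Definition derivable01 (R : realType) (f : R -> R) (t : R) : Prop :=
  cvg (quot01 f t @ within `[0, 1] t^').

Definition dot (R : realType) (f : R -> R) (t : R) : R :=
  lim (quot01 f t @ within `[0, 1] t^').

Definition abar (R : realType) (b : nat -> R) (k : nat) : R :=
  \prod_(1 <= i < k.+1) (1 - b i).

Definition beta (R : realType) (alpha : R -> R) (t : R) : R :=
  - 2 * (dot alpha t / alpha t).

Definition gsq (R : realType) (alpha sigma : R -> R) (t : R) : R :=
  dot (fun s => sigma s ^+ 2) t - 2 * (dot alpha t / alpha t) * sigma t ^+ 2.

(* Density N(x; m, S) on R^d, for S symmetric positive definite.  It is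
   written with matrix products because the library norm of 'rV[R]_d is the
   sup norm. *)
Definition gaussian (R : realType) (d : nat) (m : 'rV[R]_d) (S : 'M[R]_d)
    (x : 'rV[R]_d) : R :=
  (Num.sqrt ((2 * pi) ^+ d * \det S))^-1 *
  expR (- (((x - m) *m invmx S *m (x - m)^T) 0 0 / 2)).

Definition ddpm_path (R : realType) (d : nat) (alpha sigma : R -> R)
    (x0 : 'rV[R]_d) (t : R) : 'rV[R]_d -> R :=
  gaussian (alpha t *: x0) ((sigma t ^+ 2)%:M).

Definition pderiv (R : realType) (d : nat) (i : 'I_d) (f : 'rV[R]_d -> R)
    (x : 'rV[R]_d) : R := 'D_(delta_mx 0 i) f x.

Definition pderivable (R : realType) (d : nat) (i : 'I_d) (f : 'rV[R]_d -> R)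
    (x : 'rV[R]_d) : Prop := derivable f x (delta_mx 0 i).

Definition div (R : realType) (d : nat) (v : 'rV[R]_d -> 'rV[R]_d)
    (x : 'rV[R]_d) : R := \sum_(i < d) pderiv i (fun y => v y 0 i) x.

Definition laplacian (R : realType) (d : nat) (f : 'rV[R]_d -> R)
    (x : 'rV[R]_d) : R := \sum_(i < d) pderiv i (pderiv i f) x.

(* dX_t = v_t(X_t) dt + c_t dW_t generates the density path p on ]0, 1[, in the
   sense of the Fokker-Planck equation.  The library derivatives are total
   functions, so the existence of those in the equation is stated as well. *)
Definition generates (R : realType) (d : nat)
    (v : R -> 'rV[R]_d -> 'rV[R]_d) (c : R -> R) (p : R -> 'rV[R]_d -> R) :
    Prop :=
  forall (t : R) (x : 'rV[R]_d), 0 < t < 1 ->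
  [/\ derivable (fun s => p s x) t 1,
      forall i : 'I_d, pderivable i (fun y => (p t y *: v t y) 0 i) x,
      forall i : 'I_d, (forall y, pderivable i (p t) y) /\
                       pderivable i (pderiv i (p t)) x &
      derive1 (fun s => p s x) t =
        - div (fun y => p t y *: v t y) x
        + 2^-1 * c t ^+ 2 * laplacian (p t) x].

(* Main.v *)
Require Import Defs.
From mathcomp Require Import all_boot all_order all_algebra.
From mathcomp Require Import all_classical all_reals all_analysis.
From mathcomp Require Import ring lra.

(** Differentiating alpha^2 + sigma^2 = 1 gives sigma sigma' = - alpha alpha',
    which turns g^2 into - 2 alpha' / alpha.  For an isotropic Gaussian p with
    mean alpha x0 and variance sigma^2, all the terms of the Fokker-Planck
    equation are p times a sum over the coordinates; with y = x - alpha x0 the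
    i-th summands of the two sides differ by
      alpha' / alpha * (alpha^2 + sigma^2 - 1) / sigma^2
        * (1 - y_i^2 / sigma^2),
    which vanishes.  At the endpoints, where nonnegativity of g^2 is not
    assumed, alpha' 0 = 0 because sigma 0 = 0, and alpha' 1 <= 0 because alpha
    is nonincreasing on ]0, 1[. *)

Import Order.TTheory GRing.Theory Num.Theory.
Import numFieldNormedType.Exports.

Local Open Scope classical_set_scope.
Local Open Scope ring_scope.

(** * Derivatives taken relative to the closed unit interval *)

Section RelativeDerivative.
Variable R : realType.
Implicit Types (f g : R -> R) (t : R).

Local Notation W t := (within `[0, 1]%classic t^').

(** Properness makes limits along this filter unique, so that [dot] can be computed. Points of the
    interval accumulate at [t] from the right if [t < 1], and from the left at [t = 1]. *)
Lemma within01_proper t : 0 <= t <= 1 -> ProperFilter (W t).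
Proof.
move=> /andP[t0 t1]; apply: Build_ProperFilter.
rewrite /within /dnbhs /= /within /= => H.
have [tlt1|tge1] := ltP t 1.
  suff : \forall x \near t^'+, False by move=> /filter_ex[].
  have {}H : \forall x \near t^'+, x != t -> `[0, 1]%classic x -> False.
    exact: cvg_within.
  near=> x.
  have xt : t < x by near: x; exact: nbhs_right_gt.
  have : x != t -> `[0, 1]%classic x -> False by near: x; exact: H.
  apply; first by rewrite gt_eqF.
  have x1 : x < 1 by near: x; exact: nbhs_right_lt.
  by rewrite /= in_itv /= (le_trans t0 (ltW xt)) ltW.
have t_gt0 : 0 < t by exact: lt_le_trans tge1.
suff : \forall x \near t^'-, False by move=> /filter_ex[].
have {}H : \forall x \near t^'-, x != t -> `[0, 1]%classic x -> False.
  exact: cvg_within.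
near=> x.
have xt : x < t by near: x; exact: nbhs_left_lt.
have : x != t -> `[0, 1]%classic x -> False by near: x; exact: H.
apply; first by rewrite lt_eqF.
have x0 : 0 < x by near: x; exact: nbhs_left_gt.
by rewrite /= in_itv /= (le_trans (ltW xt) t1) ltW.
Unshelve. all: by end_near. Qed.

(** An interior point has a neighbourhood inside the interval, so the constraint is eventually
    void. *)
Lemma within01E t : 0 < t < 1 -> W t = t^'.
Proof.
move=> /andP[t0 t1]; rewrite eqEsubset; split => S; last exact: cvg_within.
rewrite /dnbhs /within /= => H.
near=> x => xt.
have : x != t -> `[0, 1]%classic x -> S x by near: x; exact: H.
apply => //=; rewrite in_itv /=; apply/andP; split; near: x.
- exact: lt_le_nbhsr.
- exact: lt_le_nbhsl.
Unshelve. all: by end_near. Qed.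

Lemma derivable01_cvg f t : derivable01 f t -> quot01 f t @ W t --> dot f t.
Proof. by []. Qed.

Lemma dotE f t l : 0 <= t <= 1 -> quot01 f t @ W t --> l -> dot f t = l.
Proof. by move=> /within01_proper t01 /cvg_lim; exact. Qed.

Lemma quot01M f g t (s : R) :
  quot01 (f \* g) t s = quot01 f t s * g s + f t * quot01 g t s.
Proof. rewrite /quot01 /=; ring. Qed.

Lemma derivable01_continuous f t : derivable01 f t -> f @ W t --> f t.
Proof.
move=> /derivable01_cvg df.
have st : (fun s : R => s - t) @ W t --> (0 : R).
  have st : (fun s : R => s - t) @ t --> (0 : R).
    rewrite -(subrr t).
    apply: (@cvgB _ _ _ (nbhs t) _ id (cst t)); first exact: cvg_id.
    exact: cvg_cst.
  by apply: cvg_within_filter; apply: cvg_within_filter.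
(* Multiplying the quotient back recovers [f]; at [s = t] the factor [s - t] is zero, so the value
   given to [0^-1] does not matter. *)
have fE : f = (fun s => f t + (s - t) * quot01 f t s).
  apply/funext => s; rewrite /quot01.
  have [->|st0] := eqVneq s t; first by rewrite !subrr mul0r addr0.
  by rewrite mulVKf ?subr_eq0// addrC subrK.
rewrite [X in X @ _]fE -[X in _ --> X]addr0.
rewrite -[X in _ --> _ + X](mul0r (dot f t)).
by apply: cvgD; [exact: cvg_cst|exact: cvgM].
Qed.

Lemma cvg_quot01_sqr f t : derivable01 f t ->
  quot01 (fun s => f s ^+ 2) t @ W t --> 2 * f t * dot f t.
Proof.
move=> df.
have -> : quot01 (fun s => f s ^+ 2) t =
    (quot01 f t \* f) \+ (cst (f t) \* quot01 f t).
  by apply/funext => s; rewrite -[RHS]quot01M.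
rewrite (_ : 2 * _ * _ = dot f t * f t + f t * dot f t); last by ring.
apply: cvgD; apply: cvgM => //; [exact: derivable01_continuous|exact: cvg_cst].
Qed.

Lemma dot_sqr f t : 0 <= t <= 1 -> derivable01 f t ->
  dot (fun s => f s ^+ 2) t = 2 * f t * dot f t.
Proof. by move=> t01 /cvg_quot01_sqr /dotE; exact. Qed.

(** The substitution [s = h + t] carries the quotient at [t] to the increment form at 0; it maps
    punctured neighbourhoods to punctured neighbourhoods. *)
Lemma derivable01_is_derive f t : 0 < t < 1 -> derivable01 f t ->
  is_derive t (1 : R) f (dot f t).
Proof.
move=> t01 /derivable01_cvg; rewrite within01E// => df.
suff H : h^-1 *: ((f \o shift t) (h *: (1 : R)) - f t) @[h --> 0^'] --> dot f t.
  by apply: DeriveDef; [exact: cvgP H | exact: (cvg_lim _ H)].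
have -> : (fun h : R => h^-1 *: ((f \o shift t) (h *: (1 : R)) - f t)) =
    quot01 f t \o shift t.
  by apply/funext => h; rewrite /quot01 /= scaler1 addrK.
apply: cvg_comp df => S; rewrite /dnbhs /within /= => tS.
have sh : (fun h : R => h + t) @ (0 : R) --> 0 + t.
  by apply: cvgD; [exact: cvg_id|exact: cvg_cst].
rewrite add0r in sh.
have {}sh : \forall h \near (0 : R), h + t != t -> S (h + t) := sh _ tS.
change (\forall h \near (0 : R), h != 0 -> S (h + t)).
near=> h => h0.
have : h + t != t -> S (h + t) by near: h.
by apply; rewrite -subr_eq0 addrK.
Unshelve. all: by end_near. Qed.
End RelativeDerivative.

(** * Derivatives of isotropic Gaussian densities in space and in time *)

Section Gaussian.
Variables (R : realType) (d : nat).
Implicit Types (m x v : 'rV[R]_d) (f : 'rV[R]_d -> R) (i : 'I_d).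

(** Restricting to the line through [x] along [v] lets the one-variable differentiation rules
    compute directional derivatives. *)
Lemma is_derive_line f x v l :
  is_derive (0 : R) (1 : R) (fun h => f (h *: v + x)) l -> is_derive x v f l.
Proof.
have E : (fun h : R => h^-1 *: (f (h *: v + x) - f x)) =
    (fun h : R => h^-1 *: (((fun h => f (h *: v + x)) \o shift 0) (h *: (1 : R))
      - f (0 *: v + x))).
  by apply/funext => h; rewrite /= addr0 scaler1 scale0r add0r.
move=> [fd fl]; split.
  by rewrite /derivable /= E.
by rewrite -fl /derive /= E.
Qed.

Lemma gaussian_scalarE m (s : R) x : gaussian m s%:M x =
  (Num.sqrt ((2 * pi) ^+ d * s ^+ d))^-1 *
  expR (- (s^-1 * (\sum_j (x 0 j - m 0 j) ^+ 2) / 2)).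
Proof.
rewrite /gaussian det_scalar invmx_scalar mul_mx_scalar -scalemxAl !mxE.
congr (_ * expR (- (_ * _ / 2))).
by apply: eq_bigr => j _; rewrite !mxE expr2.
Qed.

Lemma is_derive_coord i x v : is_derive x v (fun y : 'rV[R]_d => y 0 i) (v 0 i).
Proof.
apply: is_derive_line.
have -> : (fun h : R => (h *: v + x) 0 i) = id * cst (v 0 i) + cst (x 0 i).
  by apply/funext => h; rewrite !mxE.
apply: is_derive_eq; rewrite /= scaler0 add0r addr0.
exact: mulr1.
Qed.

Lemma is_derive_gaussian m (s : R) i x : s != 0 ->
  is_derive x (delta_mx 0 i) (gaussian m s%:M)
    (- (s^-1 * (x 0 i - m 0 i)) * gaussian m s%:M x).
Proof.
move=> s0; apply: is_derive_line.
set G := gaussian _ _ _.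
(* Moving along coordinate [i] changes a single square; expanding it adds
   [- s^-1 * (h * (x_i - m_i) + h^2 / 2)] to the exponent and leaves the constant factor [G]. *)
have -> : (fun h : R => gaussian m s%:M (h *: delta_mx 0 i + x)) =
    cst G * (expR \o (cst (- s^-1) *
      (id * cst (x 0 i - m 0 i) + cst 2^-1 * id ^+ 2))).
  apply/funext => h; rewrite /G !gaussian_scalarE /= -[RHS]mulrA -expRD.
  congr (_ * expR _); rewrite (bigD1 i)//= [in RHS](bigD1 i)//= !mxE !eqxx /=.
  have -> : \sum_(j < d | j != i) ((h *: delta_mx 0 i + x) 0 j - m 0 j) ^+ 2 =
      \sum_(j < d | j != i) (x 0 j - m 0 j) ^+ 2.
    by apply: eq_bigr => j ji; rewrite !mxE /= (negPf ji) mulr0 add0r.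
  rewrite !fctE /=; field.
  exact: s0.
apply: is_derive_eq.
rewrite !fctE /= /GRing.scale /=.
rewrite !(mulr0, mul0r, mulr1, add0r, addr0, expr1, expr0n) /= expR0; ring.
Qed.

Lemma pderiv_gaussian m (s : R) i : s != 0 ->
  pderiv i (gaussian m s%:M) =
  (fun y : 'rV[R]_d => - (s^-1 * (y 0 i - m 0 i)) * gaussian m s%:M y).
Proof.
move=> s0; apply/funext => y.
have ? := is_derive_gaussian m s i y s0; exact: derive_val.
Qed.

Lemma is_derive_pderiv_gaussian m (s : R) i x : s != 0 ->
  is_derive x (delta_mx 0 i) (pderiv i (gaussian m s%:M))
    ((- s^-1 + (s^-1 * (x 0 i - m 0 i)) ^+ 2) * gaussian m s%:M x).
Proof.
move=> s0; rewrite pderiv_gaussian//.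
have -> : (fun y : 'rV[R]_d => - (s^-1 * (y 0 i - m 0 i)) * gaussian m s%:M y) =
    cst (- s^-1) * ((fun y : 'rV[R]_d => y 0 i) - cst (m 0 i)) * gaussian m s%:M.
  by apply/funext => y; rewrite !fctE -mulNr.
have ? := is_derive_coord i x (delta_mx 0 i).
have ? := is_derive_gaussian m s i x s0.
apply: is_derive_eq.
rewrite !fctE /= /GRing.scale /= !mxE !eqxx /=; ring.
Qed.

Lemma is_derive_gaussian_drift m (s c : R) i x : s != 0 ->
  is_derive x (delta_mx 0 i) (fun y => (gaussian m s%:M y *: (c *: y)) 0 i)
    (c * (1 - s^-1 * (x 0 i - m 0 i) * x 0 i) * gaussian m s%:M x).
Proof.
move=> s0.
have -> : (fun y => (gaussian m s%:M y *: (c *: y)) 0 i) =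
    gaussian m s%:M * (cst c * (fun y : 'rV[R]_d => y 0 i)).
  by apply/funext => y; rewrite !mxE !fctE.
have ? := is_derive_coord i x (delta_mx 0 i).
have ? := is_derive_gaussian m s i x s0.
apply: is_derive_eq.
rewrite !fctE /= /GRing.scale /= !mxE !eqxx /=; ring.
Qed.

Lemma laplacian_gaussian m (s : R) x : s != 0 ->
  laplacian (gaussian m s%:M) x =
  \sum_i (- s^-1 + (s^-1 * (x 0 i - m 0 i)) ^+ 2) * gaussian m s%:M x.
Proof.
move=> s0; apply: eq_bigr => i _.
have ? := is_derive_pderiv_gaussian m s i x s0; exact: derive_val.
Qed.

Lemma div_gaussian_drift m (s c : R) x : s != 0 ->
  div (fun y => gaussian m s%:M y *: (c *: y)) x =
  \sum_i c * (1 - s^-1 * (x 0 i - m 0 i) * x 0 i) * gaussian m s%:M x.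
Proof.
move=> s0; apply: eq_bigr => i _.
have ? := is_derive_gaussian_drift m s c i x s0; exact: derive_val.
Qed.

Lemma is_derive_gaussian_time (a s : R -> R) (t da ds : R) m x :
  is_derive t (1 : R) a da -> is_derive t (1 : R) s ds -> 0 < s t ->
  is_derive t (1 : R) (fun r => gaussian (a r *: m) (s r ^+ 2)%:M x)
    (\sum_i (- (ds / s t) + (x 0 i - a t * m 0 i) * da * m 0 i / s t ^+ 2
             + (x 0 i - a t * m 0 i) ^+ 2 * ds / s t ^+ 3) *
       gaussian (a t *: m) (s t ^+ 2)%:M x).
Proof.
move=> ha hs st.
(* With [V] the inverse standard deviation and [Q] the squared distance to the mean, the density is
   [K * V^d * exp (- V^2 * Q / 2)]. The square root of the determinant takes this form where [s r]
   is positive. *)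
pose K : R := (Num.sqrt ((2 * pi) ^+ d))^-1.
pose Q : R -> R := \sum_(i < d) (cst (x 0 i) - a * cst (m 0 i)) ^+ 2.
pose V : R -> R := fun r => (s r)^-1.
have GE r : 0 < s r -> gaussian (a r *: m) (s r ^+ 2)%:M x =
    (cst K * V ^+ d * (expR \o (cst (- 2^-1) * (V ^+ 2 * Q)))) r.
  move=> sr; rewrite gaussian_scalarE !fctE /= /K /V.
  rewrite sqrtrM ?exprn_ge0//; last first.
    by rewrite mulr_ge0// pi_ge0.
  rewrite -exprM mulnC exprM sqrtr_sqr ger0_norm ?exprn_ge0 ?(ltW sr)//.
  rewrite invfM -exprVn; congr (_ * expR _).
  rewrite /Q fct_sumE -exprVn mulNr; congr (- _).
  rewrite [RHS]mulrC; congr (_ * _ / _).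
  by apply: eq_bigr => j _; rewrite !fctE !mxE.
(* Positivity of [s] persists near [t] by continuity, so the two forms have the same derivative at
   [t]. *)
have sn : \forall r \near t, 0 < s r.
  have : {for t, continuous s}.
    by apply: differentiable_continuous; apply/derivable1_diffP; exact: ex_derive.
  by move=> /cvgr_gt; exact.
apply: (@near_eq_is_derive _ _ _
    (cst K * V ^+ d * (expR \o (cst (- 2^-1) * (V ^+ 2 * Q))))).
  by near=> r; rewrite -GE//; near: r.
rewrite GE//.
have hV : is_derive t (1 : R) V (- (s t) ^- 2 *: ds).
  by apply: is_deriveV; rewrite gt_eqF.
have hQ : is_derive t (1 : R) Q
    (\sum_(i < d) (- 2 * (x 0 i - a t * m 0 i) * da * m 0 i)).
  apply: is_derive_sum => i; apply: is_derive_eq.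
  rewrite !fctE /= /GRing.scale /=; ring.
apply: is_derive_eq.
(* Differentiating [V ^+ d] yields the exponent [d.-1]; going back to [d] costs a factor [s t]. For
   [d = 0] the truncated predecessor is harmless, as both sides vanish. *)
have dX : d%:R * V t ^+ d.-1 = d%:R * V t ^+ d * s t.
  case: (d) => [|n]; first by rewrite !mul0r.
  by rewrite /= exprSr /V mulrA mulfVK// gt_eqF.
(* All sums over coordinates are folded into [A] and [Q t], which [field] then treats as atoms. *)
pose A := \sum_i (x 0 i - a t * m 0 i) * da * m 0 i.
have QE : Q t = \sum_i (x 0 i - a t * m 0 i) ^+ 2 by rewrite /Q fct_sumE.
have -> : \sum_(i < d) (-2 * (x 0 i - a t * m 0 i) * da * m 0 i) = - 2 * A.
  by rewrite mulr_sumr; apply: eq_bigr => i _; rewrite !mulrA.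
rewrite -mulr_suml !big_split /= sumr_const card_ord -!mulr_suml -/A -QE.
rewrite -mulr_natr !fctE /= /GRing.scale /= dX.
have VE : V t = (s t)^-1 by [].
rewrite VE; field.
by rewrite gt_eqF.
Unshelve. all: by end_near. Qed.
End Gaussian.

(** * Consequences of the variance-preserving constraint *)

Section DDPM.
Variables (R : realType) (alpha sigma : R -> R).
Hypotheses (alphaD : forall t : R, 0 <= t <= 1 -> derivable01 alpha t)
  (sigmaD : forall t : R, 0 <= t <= 1 -> derivable01 sigma t)
  (VP : forall t : R, 0 <= t <= 1 -> alpha t ^+ 2 + sigma t ^+ 2 = 1).

(** By the constraint, the difference quotients of [sigma ^+ 2] and [alpha ^+ 2] are opposite at all
    times of the interval, hence so are their limits, endpoints included. *)
Lemma dot_sigma_sqr t : 0 <= t <= 1 ->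
  dot (fun s => sigma s ^+ 2) t = - (2 * alpha t * dot alpha t).
Proof.
move=> t01; apply: dotE => //.
have /cvgN := cvg_quot01_sqr _ _ _ (alphaD _ t01).
apply: cvg_trans; apply: near_eq_cvg.
near=> s; have s01 : 0 <= s <= 1.
  by near: s; apply: filterS (withinT _ _) => s; rewrite /= in_itv.
rewrite fctE /quot01 -mulrN; congr (_ * _).
by have := VP _ t01; have := VP _ s01; lra.
Unshelve. all: by end_near. Qed.

Lemma alpha_sigma_dot t : 0 <= t <= 1 ->
  alpha t * dot alpha t + sigma t * dot sigma t = 0.
Proof.
move=> t01; have := dot_sigma_sqr _ t01; rewrite dot_sqr//; last exact: sigmaD.
lra.
Qed.

(** Once [sigma t ^+ 2] is replaced by [1 - alpha t ^+ 2], the terms in [alpha t * dot alpha t]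
    cancel. The only division is by [alpha t], so times with [sigma t = 0] are covered. *)
Lemma beta_gsq t : 0 <= t <= 1 -> 0 < alpha t ->
  beta alpha t = gsq alpha sigma t.
Proof.
move=> t01 a0; rewrite /beta /gsq dot_sigma_sqr//.
have -> : sigma t ^+ 2 = 1 - alpha t ^+ 2 by have := VP _ t01; lra.
by field; rewrite gt_eqF.
Qed.

(** Monotonicity inside the interval extends to a comparison with [alpha 1] by continuity; the
    quotients at 1 are then nonpositive, and so is their limit. *)
Lemma dot_alpha1_le0 : (forall t : R, 0 < t < 1 -> dot alpha t <= 0) ->
  dot alpha 1 <= 0.
Proof.
move=> dle0.
have i01 : 0 <= (1 : R) <= 1 by rewrite ler01 lexx.
have F1 := within01_proper _ _ i01.
have aD (t : R) : 0 < t < 1 -> is_derive t (1 : R) alpha (dot alpha t).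
  move=> t01; apply: derivable01_is_derive => //; apply: alphaD.
  by case/andP: t01 => /ltW -> /ltW ->.
have decr (s u : R) : 0 < s -> s <= u -> u < 1 -> alpha u <= alpha s.
  move=> s0 su u1.
  have D (x : R) : x \in `[s, u] -> is_derive x (1 : R) alpha (dot alpha x).
    rewrite in_itv /= => /andP[sx xu].
    by apply: aD; rewrite (lt_le_trans s0 sx) (le_lt_trans xu u1).
  apply: (@ler0_derive1_le_cc _ alpha s u) => //.
  - by move=> x /subset_itv_oo_cc/D[].
  - move=> x xsu; have := D x (subset_itv_oo_cc xsu) => -[_].
    rewrite derive1E => ->; apply: dle0.
    move: xsu; rewrite in_itv /= => /andP[sx xu].
    by rewrite (lt_trans s0 sx) (lt_trans xu u1).
  - by apply: derivable_within_continuous => x /D[].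
  - by rewrite in_itv /= lexx su.
  - by rewrite in_itv /= su lexx.
have near1 (s : R) : s < 1 ->
    \forall u \near within `[0, 1]%classic (1 : R)^', s <= u < 1.
  move=> s1.
  change (\forall u \near (1 : R), u != 1 -> `[0, 1]%classic u -> s <= u < 1).
  near=> u => u1; rewrite /= in_itv /= => /andP[_ ul].
  rewrite lt_neqAle u1 ul !andbT.
  by near: u; exact: lt_le_nbhsr.
have decr1 (s : R) : 0 < s -> s < 1 -> alpha 1 <= alpha s.
  move=> s0 s1; apply: (@cvgr_to_le _ _ F1 _ alpha).
    exact/derivable01_continuous/alphaD.
  by apply: filterS (near1 s s1) => u /andP[su u1]; apply: decr.
apply: (@cvgr_to_le _ _ F1 _ (quot01 alpha 1)).
  exact/derivable01_cvg/alphaD.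
(* Any bound strictly between 0 and 1 would do: it keeps [u] positive, as [decr1] requires. *)
have h : (2^-1 : R) < 1 by lra.
apply: filterS (near1 _ h) => u /andP[u0 u1].
rewrite /quot01 mulr_le0_ge0 ?invr_le0 ?subr_le0 ?subr_ge0 ?(ltW u1)//.
apply: decr1 => //; lra.
Unshelve. all: by end_near. Qed.

End DDPM.

(** * Endpoint values and the Fokker-Planck equation of the forward path *)

Lemma abar_gt0 (R : realType) (b : nat -> R) (N : nat) :
  (forall k : nat, (1 <= k <= N)%N -> 0 < b k < 1) -> 0 < abar b N.
Proof.
move=> hb; rewrite /abar big_nat_cond; apply: prodr_gt0 => i.
by rewrite andbT ltnS => /hb/andP[_]; rewrite subr_gt0.
Qed.

Theorem theorem7p4 (R : realType) (d N : nat) (tau b : nat -> R)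
    (alpha sigma : R -> R)
    (htau0 : tau 0%N = 0) (htauN : tau N = 1)
    (htau : forall k : nat, (k < N)%N -> tau k < tau k.+1)
    (hb : forall k : nat, (1 <= k <= N)%N -> 0 < b k < 1)
    (halphaD : forall t : R, 0 <= t <= 1 -> derivable01 alpha t)
    (hsigmaD : forall t : R, 0 <= t <= 1 -> derivable01 sigma t)
    (halpha_ge0 : forall t : R, 0 <= t <= 1 -> 0 <= alpha t)
    (hsigma_ge0 : forall t : R, 0 <= t <= 1 -> 0 <= sigma t)
    (halpha_grid : forall k : nat, (k <= N)%N ->
       alpha (tau k) = Num.sqrt (abar b k))
    (hsigma_grid : forall k : nat, (k <= N)%N ->
       sigma (tau k) = Num.sqrt (1 - abar b k))
    (hVP : forall t : R, 0 <= t <= 1 -> alpha t ^+ 2 + sigma t ^+ 2 = 1)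
    (halpha_gt0 : forall t : R, 0 < t < 1 -> 0 < alpha t)
    (hsigma_gt0 : forall t : R, 0 < t < 1 -> 0 < sigma t)
    (hg : forall t : R, 0 < t < 1 -> 0 <= gsq alpha sigma t) :
  [/\ forall t : R, 0 <= t <= 1 ->
        beta alpha t = gsq alpha sigma t /\ 0 <= gsq alpha sigma t,
      forall x0 : 'rV[R]_d,
        generates (fun t x => - (2^-1 * beta alpha t) *: x)
                  (fun t => Num.sqrt (beta alpha t))
                  (ddpm_path alpha sigma x0) &
      forall (x0 : 'rV[R]_d) (t : R) (x : 'rV[R]_d), 0 < t < 1 ->
        derive1 (fun s => ddpm_path alpha sigma x0 s x) t =
          - div (fun y => ddpm_path alpha sigma x0 t y *:
                          (- (2^-1 * beta alpha t) *: y)) x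
          + 2^-1 * beta alpha t * laplacian (ddpm_path alpha sigma x0 t) x].
Proof.
(* The values at time 0 come from the empty product [abar b 0]. *)
have alpha0 : alpha 0 = 1.
  by rewrite -htau0 halpha_grid// /abar big_geq// sqrtr1.
have sigma0 : sigma 0 = 0.
  by rewrite -htau0 hsigma_grid// /abar big_geq// subrr sqrtr0.
have alpha1_gt0 : 0 < alpha 1.
  by rewrite -htauN halpha_grid// sqrtr_gt0 abar_gt0.
have oo_cc (t : R) : 0 < t < 1 -> 0 <= t <= 1.
  by case/andP => /ltW -> /ltW ->.
have alpha_gt0 (t : R) : 0 <= t <= 1 -> 0 < alpha t.
  rewrite !le_eqVlt => /andP[/orP[/eqP<- _|t0]]; first by rewrite alpha0.
  by move=> /orP[/eqP->//|t1]; apply: halpha_gt0; rewrite t0.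
have bg (t : R) : 0 <= t <= 1 -> beta alpha t = gsq alpha sigma t.
  by move=> t01; apply: beta_gsq => //; apply: alpha_gt0.
have dot0 : dot alpha 0 = 0.
  have i01 : 0 <= (0 : R) <= 1 by rewrite lexx ler01.
  have := alpha_sigma_dot _ _ _ halphaD hsigmaD hVP _ i01.
  by rewrite alpha0 sigma0 mul0r addr0 mul1r.
(* This translates the sign of [gsq] into monotonicity of [alpha], and back again at the
   endpoints. *)
have beta_dot (t : R) : 0 <= t <= 1 -> (0 <= beta alpha t) = (dot alpha t <= 0).
  move=> t01; rewrite /beta mulNr oppr_ge0 pmulr_rle0//.
  by rewrite pmulr_lle0// invr_gt0 alpha_gt0.
have dle0 (t : R) : 0 < t < 1 -> dot alpha t <= 0.
  move=> t01; rewrite -beta_dot ?bg//; [exact: hg|exact: oo_cc|exact: oo_cc].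
have beta_ge0 (t : R) : 0 <= t <= 1 -> 0 <= beta alpha t.
  move=> t01; rewrite beta_dot//; move: t01 => /andP[].
  rewrite le_eqVlt => /orP[/eqP<- _|t0]; first by rewrite dot0.
  rewrite le_eqVlt => /orP[/eqP->|t1]; last by apply: dle0; rewrite t0.
  exact: dot_alpha1_le0.
have vne0 (t : R) : 0 < t < 1 -> sigma t ^+ 2 != 0.
  by move=> t01; rewrite expf_neq0// gt_eqF// hsigma_gt0.
have dt (x0 : 'rV[R]_d) (t : R) (x : 'rV[R]_d) : 0 < t < 1 -> _ :=
  fun t01 => is_derive_gaussian_time _ _ _ _ _ _ _ x0 x
   (derivable01_is_derive _ _ _ t01 (halphaD _ (oo_cc _ t01)))
   (derivable01_is_derive _ _ _ t01 (hsigmaD _ (oo_cc _ t01)))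
   (hsigma_gt0 _ t01).
have FP (x0 : 'rV[R]_d) (t : R) (x : 'rV[R]_d) : 0 < t < 1 ->
    derive1 (fun s => ddpm_path alpha sigma x0 s x) t =
      - div (fun y => ddpm_path alpha sigma x0 t y *:
                      (- (2^-1 * beta alpha t) *: y)) x
      + 2^-1 * beta alpha t * laplacian (ddpm_path alpha sigma x0 t) x.
  move=> t01; have ? := dt x0 t x t01.
  (* Both sides become sums over the coordinates and are compared summand by summand. *)
  rewrite derive1E derive_val /ddpm_path div_gaussian_drift ?vne0//.
  rewrite laplacian_gaussian ?vne0// -sumrN mulr_sumr -big_split.
  apply: eq_bigr => i _ /=; rewrite mxE.
  have a0 := alpha_gt0 _ (oo_cc _ t01); have s0 := hsigma_gt0 _ t01.
  (* Solving the differentiated constraint for [dot sigma t] leaves [dot alpha t] as the only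
     derivative. *)
  have sD : dot sigma t = - alpha t * dot alpha t / sigma t.
    have := alpha_sigma_dot _ _ _ halphaD hsigmaD hVP _ (oo_cc _ t01).
    move=> /eqP; rewrite addrC addr_eq0 => /eqP h.
    by rewrite mulNr -h mulrC mulKf// gt_eqF.
  set G := gaussian _ _ _; set y := x 0 i - alpha t * x0 0 i.
  rewrite sD /beta; apply/subr0_eq.
  (* The constraint is invisible to [field]; this form isolates it in one factor, which [hVP] then
     makes zero. *)
  transitivity (dot alpha t / alpha t * ((alpha t ^+ 2 + sigma t ^+ 2 - 1)
    / sigma t ^+ 2) * (1 - y ^+ 2 / sigma t ^+ 2) * G).
    by rewrite /y; field; rewrite !gt_eqF.
  by rewrite hVP ?oo_cc// subrr mul0r mulr0 !mul0r.
split => [t t01|x0 t x t01|//].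
  by rewrite -bg// beta_ge0.
split.
- by have [] := dt x0 t x t01.
- by move=> i; have [] := is_derive_gaussian_drift _ _ (alpha t *: x0) _
    (- (2^-1 * beta alpha t)) i x (vne0 _ t01).
- move=> i; split => [y|].
    by have [] := is_derive_gaussian _ _ (alpha t *: x0) _ i y (vne0 _ t01).
  by have [] := is_derive_pderiv_gaussian _ _ (alpha t *: x0) _ i x (vne0 _ t01).
(* Nonnegativity of [beta] matters here: [Num.sqrt] of a negative number would be 0. *)
- by rewrite FP// sqr_sqrtr// beta_ge0// oo_cc.
Qed.
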